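(* Let $\boldsymbol{x}\in\{0,1\}^{\mathcal F}$ with $\sum_{f\in\mathcal F}x_f\le N_c$. The nonlinear follower problem (defined in the context) can be equivalently written as the following mixed-binary linear program in the variables $\boldsymbol{y}=(y_{f,i})$, $\boldsymbol{\lambda}=(\lambda_{f,i})$, $\boldsymbol{v}=(\boldsymbol{v_{f,i}})$ and $\boldsymbol{\zeta}=(\zeta_{f,s,i})$, where $\boldsymbol{v_{f,i}}\in\mathbb R^L$ and $\zeta_{f,s,i}$ is defined for $f,s\in\mathcal F$ with $(s,f)\in\mathcal A$ and $i\in\{2,\dots,N_p\}$: $$\max\ \sum_{f\in\mathcal F}\sum_{i=1}^{N_p}W_f\,y_{f,i}$$ subject to $$\begin{aligned} & y_{f,1}\le1-x_f, && f\in\mathcal F,\\ & y_{f,i}\le y_{f,i-1}, && f\in\mathcal F,\ i\in\{2,\dots,N_p\},\\ & y_{f,i}\le(\boldsymbol{u^f})^\top\boldsymbol{v_{f,i}}+\lambda_{f,i}, && f\in\mathcal F,\ i\in\{1,\dots,N_p\},\\ & (\boldsymbol{U^f_s})^\top\boldsymbol{v_{f,1}}+\lambda_{f,1}x_s\le0, && f,s\in\mathcal F,\ (s,f)\in\mathcal A,\\ & (\boldsymbol{U^f_s})^\top\boldsymbol{v_{f,i}}\le0, && f,s\in\mathcal F,\ (s,f)\notin\mathcal A,\ i\in\{1,\dots,N_p\},\\ & \boldsymbol{v_{f,i}}\ge0,\quad 0\le y_{f,i}\le1, && f\in\mathcal F,\ i\in\{1,\dots,N_p\},\\ & (\boldsymbol{U^f_s})^\top\boldsymbol{v_{f,i}}+\lambda_{f,i}-\zeta_{f,s,i}\le0,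 && f,s\in\mathcal F,\ (s,f)\in\mathcal A,\ i\in\{2,\dots,N_p\},\\ & \zeta_{f,s,i}\ge0,\quad \zeta_{f,s,i}\ge\lambda_{f,i}+y_{s,i-1}-1, && f,s\in\mathcal F,\ (s,f)\in\mathcal A,\ i\in\{2,\dots,N_p\},\\ & \zeta_{f,s,i}\le\lambda_{f,i},\quad \zeta_{f,s,i}\le y_{s,i-1}, && f,s\in\mathcal F,\ (s,f)\in\mathcal A,\ i\in\{2,\dots,N_p\},\\ & \lambda_{f,i}\in\{0,1\}, && f\in\mathcal F,\ i\in\{1,\dots,N_p\}. \end{aligned}$$ Here ''equivalently written'' means: a vector $\boldsymbol{y}$ can be completed to a feasible point of one problem if and only if it can be completed to a feasible point of the other (the objectives are the same function of $\boldsymbol{y}$, so the optimal values coincide).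
   Context: $\mathcal F$ is a finite set of assets, $N=|\mathcal F|$; $N_c\le N$ and $N_p\ge1$ are integers; $\mathcal A\subset\mathcal F\times\mathcal F$ is a set of directed arcs; $W_f\ge0$ are weights. $L$ is a finite index set, and $U^f_{l,s},u^f_l$ ($l\in L$, $f,s\in\mathcal F$) are given real constants describing, for each $f\in\mathcal F$, the polytope of admissible arc weights $\mathcal P_f=\{(P_s)_{s\in\mathcal F}:P_s\ge0,\ \sum_{s\in\mathcal F}U^f_{l,s}P_s\ge u^f_l\ \forall l\in L\}$. Put $\boldsymbol{u^f}=(u^f_l)_{l\in L}$ and $\boldsymbol{U^f_s}=(U^f_{l,s})_{l\in L}$ in $\mathbb R^L$. The nonlinear follower problem for given $\boldsymbol{x}$ is: maximize $\sum_{f\in\mathcal F}\sum_{i=1}^{N_p}W_fy_{f,i}$ over $\boldsymbol{y},\boldsymbol{\lambda},\boldsymbol{v}$ subject to $$\begin{aligned} & y_{f,1}\le 1-x_f\ (f\in\mathcal F),\qquad y_{f,i}\le y_{f,i-1}\ (f\in\mathcal F,\ 2\le i\le N_p),\\ & y_{f,i}\le(\boldsymbol{u^f})^\top\boldsymbol{v_{f,i}}+\lambda_{f,i}\ (f\in\mathcal F,\ 1\le i\le N_p),\\ & (\boldsymbol{U^f_s})^\top\boldsymbol{v_{f,1}}+\lambda_{f,1}x_s\le0\ ((s,f)\in\mathcal A),\\ & (\boldsymbol{U^f_s})^\top\boldsymbol{v_{f,i}}+\lambda_{f,i}(1-y_{s,i-1})\le0\ ((s,f)\in\mathcal A,\ 2\le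 i\le N_p),\\ & (\boldsymbol{U^f_s})^\top\boldsymbol{v_{f,i}}\le0\ (f,s\in\mathcal F,\ (s,f)\notin\mathcal A,\ 1\le i\le N_p),\\ & \boldsymbol{v_{f,i}}\ge0,\quad 0\le y_{f,i}\le1,\quad 0\le\lambda_{f,i}\le1\ (f\in\mathcal F,\ 1\le i\le N_p). \end{aligned}$$ *)

(* Defs.v *)
From HB Require Import structures.
From mathcomp Require Import all_boot all_order all_algebra.
From mathcomp Require Import classical_sets reals constructive_ereal ereal.

Set Implicit Arguments.
Unset Strict Implicit.
Unset Printing Implicit Defensive.

Import Order.TTheory GRing.Theory Num.Theory.
Local Open Scope classical_set_scope.
Local Open Scope ring_scope.

(* The period i in {1, ..., Np} is encoded by the ordinal of 'I_Np with value
   i - 1.  Thus "period 1" is [i = 0%N :> nat], and an index i in {2, ..., Np}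
   together with its predecessor i - 1 is a pair (i, j) such that
   [i = j.+1 :> nat].
   [U f l s] and [u f l] stand for U^f_{l,s} and u^f_l; the constants are
   arbitrary (the polytopes {P >= 0 | sum_s U^f_{l,s} P_s >= u^f_l for all l}
   are required neither to be nonempty nor to be bounded). *)

Definition dot (R : realType) (L : finType) (a b : L -> R) : R :=
  \sum_(l : L) a l * b l.

Definition follower_objective (R : realType) (F : finType) (Np : nat)
    (W : F -> R) (y : F -> 'I_Np -> R) : R :=
  \sum_(f : F) \sum_(i < Np) W f * y f i.

Record nonlinear_feasible (R : realType) (F L : finType) (Np : nat)
    (A : {set F * F}) (U : F -> L -> F -> R) (u : F -> L -> R) (x : F -> R)
    (y lam : F -> 'I_Np -> R) (v : F -> 'I_Np -> L -> R) : Prop := {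
  nl_init : forall f (i : 'I_Np), i = 0%N :> nat -> y f i <= 1 - x f;
  nl_mono : forall f (i j : 'I_Np), i = j.+1 :> nat -> y f i <= y f j;
  nl_dual : forall f (i : 'I_Np), y f i <= dot (u f) (v f i) + lam f i;
  nl_arc_init : forall f s (i : 'I_Np), (s, f) \in A -> i = 0%N :> nat ->
    dot (fun l => U f l s) (v f i) + lam f i * x s <= 0;
  nl_arc : forall f s (i j : 'I_Np), (s, f) \in A -> i = j.+1 :> nat ->
    dot (fun l => U f l s) (v f i) + lam f i * (1 - y s j) <= 0;
  nl_nonarc : forall f s (i : 'I_Np), (s, f) \notin A ->
    dot (fun l => U f l s) (v f i) <= 0;
  nl_v_ge0 : forall f (i : 'I_Np) l, 0 <= v f i l;
  nl_y_bound : forall f (i : 'I_Np), 0 <= y f i <= 1;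
  nl_lam_bound : forall f (i : 'I_Np), 0 <= lam f i <= 1
}.

(* The variable zeta_{f,s,i} is [zeta f s i]; it only exists for (s, f) in A
   and i in {2, ..., Np}.  The remaining values of the total function [zeta]
   occur in no constraint. *)
Record mixed_binary_feasible (R : realType) (F L : finType) (Np : nat)
    (A : {set F * F}) (U : F -> L -> F -> R) (u : F -> L -> R) (x : F -> R)
    (y lam : F -> 'I_Np -> R) (v : F -> 'I_Np -> L -> R)
    (zeta : F -> F -> 'I_Np -> R) : Prop := {
  mb_init : forall f (i : 'I_Np), i = 0%N :> nat -> y f i <= 1 - x f;
  mb_mono : forall f (i j : 'I_Np), i = j.+1 :> nat -> y f i <= y f j;
  mb_dual : forall f (i : 'I_Np), y f i <= dot (u f) (v f i) + lam f i;
  mb_arc_init : forall f s (i : 'I_Np), (s, f) \in A -> i = 0%N :> nat ->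
    dot (fun l => U f l s) (v f i) + lam f i * x s <= 0;
  mb_nonarc : forall f s (i : 'I_Np), (s, f) \notin A ->
    dot (fun l => U f l s) (v f i) <= 0;
  mb_v_ge0 : forall f (i : 'I_Np) l, 0 <= v f i l;
  mb_y_bound : forall f (i : 'I_Np), 0 <= y f i <= 1;
  mb_arc : forall f s (i j : 'I_Np), (s, f) \in A -> i = j.+1 :> nat ->
    dot (fun l => U f l s) (v f i) + lam f i - zeta f s i <= 0;
  mb_zeta_ge0 : forall f s (i j : 'I_Np), (s, f) \in A -> i = j.+1 :> nat ->
    0 <= zeta f s i;
  mb_zeta_ge : forall f s (i j : 'I_Np), (s, f) \in A -> i = j.+1 :> nat ->
    lam f i + y s j - 1 <= zeta f s i;
  mb_zeta_le_lam : forall f s (i j : 'I_Np), (s, f) \in A ->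
    i = j.+1 :> nat -> zeta f s i <= lam f i;
  mb_zeta_le_y : forall f s (i j : 'I_Np), (s, f) \in A ->
    i = j.+1 :> nat -> zeta f s i <= y s j;
  mb_lam_binary : forall f (i : 'I_Np), lam f i = 0 \/ lam f i = 1
}.

Definition nonlinear_completable (R : realType) (F L : finType) (Np : nat)
    (A : {set F * F}) (U : F -> L -> F -> R) (u : F -> L -> R) (x : F -> R)
    : set (F -> 'I_Np -> R) :=
  [set y | exists lam v, nonlinear_feasible A U u x y lam v].

Definition mixed_binary_completable (R : realType) (F L : finType) (Np : nat)
    (A : {set F * F}) (U : F -> L -> F -> R) (u : F -> L -> R) (x : F -> R)
    : set (F -> 'I_Np -> R) :=
  [set y | exists lam v zeta, mixed_binary_feasible A U u x y lam v zeta].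

(* Optimal value as a supremum in the extended reals, so that an infeasible
   problem has value -oo. *)
Definition optimal_value (R : realType) (F : finType) (Np : nat)
    (W : F -> R) (Y : set (F -> 'I_Np -> R)) : \bar R :=
  ereal_sup [set (follower_objective W y)%:E | y in Y].

(* Main.v *)
(** Fix y and a pair (f, i).  The constraints on the arcs and v >= 0 are
    homogeneous in (v, lam), so if lam > 0 one may replace (v, lam) by
    (v / lam, 1): the right-hand side u v + lam of the bound on y is divided
    by lam <= 1, hence still dominates y >= 0.  So lam may be taken binary, and
    for binary lam the constraints on zeta say exactly zeta = lam y. *)
Require Import Defs.
From HB Require Import structures.
From mathcomp Require Import all_boot all_order all_algebra.
From mathcomp Require Import classical_sets reals constructive_ereal ereal.
From mathcomp Require Import lra.

Set Implicit Arguments.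
Unset Strict Implicit.
Unset Printing Implicit Defensive.

Import Order.TTheory GRing.Theory Num.Theory.
Local Open Scope classical_set_scope.
Local Open Scope ring_scope.

Lemma dotZr (R : realType) (L : finType) (k : R) (a b : L -> R) :
  dot a (fun l => k * b l) = k * dot a b.
Proof. by rewrite /dot mulr_sumr; apply: eq_bigr => l _; rewrite mulrCA. Qed.

(** At [lam = 0] the factor is [1], not the default [0^-1 = 0]: [v] is then left unchanged, and the
    factor is at least [1] on all of [[0, 1]]. *)
Definition round_scale (R : realType) (lam : R) : R :=
  if lam == 0 then 1 else lam^-1.

Definition round_up (R : realType) (lam : R) : R := (lam != 0)%:R.

Lemma round_up_binary (R : realType) (lam : R) :
  round_up lam = 0 \/ round_up lam = 1.
Proof. by rewrite /round_up; case: eqP; [left | right]. Qed.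

Lemma round_scaleK (R : realType) (lam : R) :
  round_scale lam * lam = round_up lam.
Proof.
rewrite /round_scale /round_up; have [->|lam0] := eqVneq lam 0.
  by rewrite mulr0.
by rewrite mulVf.
Qed.

Lemma round_scale_ge1 (R : realType) (lam : R) :
  0 <= lam <= 1 -> 1 <= round_scale lam.
Proof.
move=> /andP[lam_ge0 lam_le1]; rewrite /round_scale.
have [//|lam0] := eqVneq lam 0.
by rewrite invf_ge1 // lt_neqAle eq_sym lam0.
Qed.

Lemma round_le (R : realType) (L : finType) (a v : L -> R) (lam y : R) :
  0 <= lam <= 1 -> 0 <= y -> y <= dot a v + lam ->
  y <= dot a (fun l => round_scale lam * v l) + round_up lam.
Proof.
move=> lam01 y0 ley; rewrite dotZr -round_scaleK -mulrDr.
have k1 := round_scale_ge1 lam01.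
apply: (le_trans (ler_peMl y0 k1)).
by rewrite ler_wpM2l // (le_trans ler01).
Qed.

(** Both terms are multiplied by the same nonnegative factor. The coefficient [c] stands for [x s]
    in the first period and for [1 - y s j] later. *)
Lemma round_cone (R : realType) (L : finType) (a v : L -> R) (lam c : R) :
  0 <= lam <= 1 -> dot a v + lam * c <= 0 ->
  dot a (fun l => round_scale lam * v l) + round_up lam * c <= 0.
Proof.
move=> lam01 le0; rewrite dotZr -round_scaleK -mulrA -mulrDr.
by rewrite mulr_ge0_le0 // (le_trans ler01) ?round_scale_ge1.
Qed.

(** The four inequalities are the McCormick envelope of the product [lam * y], which is tight at the
    endpoints of [lam]: [z] is squeezed between [0] and [lam] if [lam = 0], and between [y] and [y]
    if [lam = 1]. *)
Lemma mccormick_binary (R : realType) (lam y z : R) :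
  lam = 0 \/ lam = 1 -> 0 <= y <= 1 ->
  [/\ 0 <= z, lam + y - 1 <= z, z <= lam & z <= y] <-> z = lam * y.
Proof.
move=> lam01 /andP[y0 y1]; split.
  by case=> z0 zge zlam zy; case: lam01 => lamE; subst lam; lra.
by move=> ->; case: lam01 => ->; split; lra.
Qed.

(** Total predecessor, so that [zeta] can be defined at every period; the first period is sent to
    itself, where [zeta] is unconstrained. *)
Definition ord_prev (n : nat) (i : 'I_n) : 'I_n :=
  Ordinal (leq_ltn_trans (leq_pred i) (ltn_ord i)).

Lemma ord_prevE (n : nat) (i j : 'I_n) : i = j.+1 :> nat -> ord_prev i = j.
Proof. by move=> ij; apply: val_inj; rewrite /= ij. Qed.

Lemma nonlinear_mixed_binary (R : realType) (F L : finType) (Np : nat)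
    (A : {set F * F}) (U : F -> L -> F -> R) (u : F -> L -> R) (x : F -> R)
    (y : F -> 'I_Np -> R) :
  nonlinear_completable A U u x y -> mixed_binary_completable A U u x y.
Proof.
case=> lam [v [init mono dual arc0 arc nonarc v0 y01 lam01]].
(* Each pair [(f, i)] gets its own factor: distinct pairs are coupled only through [y], which stays
   fixed. *)
exists (fun f i => round_up (lam f i)).
exists (fun f i l => round_scale (lam f i) * v f i l).
exists (fun f s i => round_up (lam f i) * y s (ord_prev i)).
have zetaP f s (i : 'I_Np) :=
  (mccormick_binary (round_up (lam f i) * y s (ord_prev i))
    (round_up_binary (lam f i)) (y01 s (ord_prev i))).2 erefl.
have scale_ge0 f i : 0 <= round_scale (lam f i).
  by rewrite (le_trans ler01) ?round_scale_ge1.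
split=> //.
- by move=> f i; apply: round_le => //; case/andP: (y01 f i).
- by move=> f s i sfA i0; apply: round_cone => //; apply: arc0.
- move=> f s i sfA; rewrite dotZr mulr_ge0_le0 //; exact: nonarc.
- by move=> f i l; rewrite mulr_ge0.
(* With [zeta] the product, [lam - zeta] factors as [lam * (1 - y s j)], the form that [round_cone]
   handles. *)
- move=> f s i j sfA ij; rewrite (ord_prevE ij) -addrA.
  rewrite -[X in _ + (X - _)]mulr1 -mulrBr.
  by apply: round_cone => //; apply: arc.
- by move=> f s i j _ _; case: (zetaP f s i).
- by move=> f s i j _ ij; case: (zetaP f s i); rewrite (ord_prevE ij).
- by move=> f s i j _ _; case: (zetaP f s i).
- by move=> f s i j _ ij; case: (zetaP f s i); rewrite (ord_prevE ij).
- by move=> f i; apply: round_up_binary.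
Qed.

Lemma mixed_binary_nonlinear (R : realType) (F L : finType) (Np : nat)
    (A : {set F * F}) (U : F -> L -> F -> R) (u : F -> L -> R) (x : F -> R)
    (y : F -> 'I_Np -> R) :
  mixed_binary_completable A U u x y -> nonlinear_completable A U u x y.
Proof.
case=> lam [v [zeta [init mono dual arc0 nonarc v0 y01 arc z0 zge zlam zy]]].
move=> lamB.
exists lam, v; split=> //.
- move=> f s i j sfA ij.
  have zE : zeta f s i = lam f i * y s j.
    apply/(mccormick_binary _ (lamB f i) (y01 s j)).
    by split; [apply: z0 ij | apply: zge | apply: zlam ij | apply: zy].
  by rewrite mulrBr mulr1 addrA -zE; apply: arc ij.
- by move=> f i; case: (lamB f i) => ->; rewrite lexx ler01.
Qed.

Theorem corollary1 (R : realType) (F L : finType) (Nc : int) (Np : nat)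
    (A : {set F * F}) (W : F -> R) (U : F -> L -> F -> R) (u : F -> L -> R)
    (x : F -> R)
    (hNc : Nc <= #|F|%:Z) (hNp : (1 <= Np)%N)
    (hW : forall f, 0 <= W f)
    (hx01 : forall f, x f = 0 \/ x f = 1)
    (hx : \sum_(f : F) x f <= Nc%:~R) :
  (forall y : F -> 'I_Np -> R,
     nonlinear_completable A U u x y <-> mixed_binary_completable A U u x y) /\
  optimal_value W (@nonlinear_completable R F L Np A U u x) =
  optimal_value W (@mixed_binary_completable R F L Np A U u x).
Proof.
have E y :
    nonlinear_completable A U u x y <-> mixed_binary_completable A U u x y.
  by split; [apply: nonlinear_mixed_binary | apply: mixed_binary_nonlinear].
(* The objective depends on [y] alone, so equality of the two sets of completable [y] suffices. *)
split=> //; congr optimal_value.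
by apply/seteqP; split=> y /E.
Qed.
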